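(* Consider an exponential family on a separable metric space $(\Omega,d)$ in natural parametrization, i.e. probability measures $\mu_\eta$ with densities $p_\eta(x)=h(x)\exp\{\eta^\top T(x)-A(\eta)\}$, $\eta\in\mathcal H$, with respect to a common dominating measure $\nu$, where the natural parameter space $\mathcal H\subset\mathbb R^p$ is open, $T:\Omega\to\mathbb R^p$ is measurable, $A:\mathcal H\to\mathbb R$, and the Fisher information matrix $\mathcal I_\eta=\partial^2A(\eta)/(\partial\eta\,\partial\eta^\top)$ is non-singular. Let $\eta_0\in\mathcal H$ be the true parameter, estimated by maximum likelihood, so that the estimating function is the score $\psi_\eta(x)=T(x)-\partial A(\eta)/\partial\eta$, and let $X\sim\mu_{\eta_0}$. Then the covariance $\tilde{\mathcal C}$ of the limiting Gaussian process under the composite null hypothesis (defined in the context) simplifies to $$\tilde{\mathcal C}_{(\omega_1,t_1),(\omega_2,t_2)}=\mathcal C_{(\omega_1,t_1),(\omega_2,t_2)}-\dot F_{\omega_1}^{\eta_0}(t_1)^\top\mathcal I_{\eta_0}^{-1}\dot F_{\omega_2}^{\eta_0}(t_2)$$ for every $(\omega_1,t_1),(\omega_2,t_2)\in\Omega\times\mathbb R_{\ge0}$.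
   Context: The distance profile of $\mu_\eta$ at $\omega$ is $F_\omega^{\mu_\eta}(t)=\mu_\eta(\{x:d(\omega,x)\le t\})$, $t\ge0$; $\dot F_\omega^{\eta_0}(t)=\partial F_\omega^{\mu_\eta}(t)/\partial\eta|_{\eta=\eta_0}\in\mathbb R^p$; $y_{\omega,t}(x)=1_{\{d(\omega,x)\le t\}}$; and $\mathcal C_{(\omega_1,t_1),(\omega_2,t_2)}=\mathsf P(d(\omega_1,X)\le t_1,d(\omega_2,X)\le t_2)-F_{\omega_1}^{\mu_{\eta_0}}(t_1)F_{\omega_2}^{\mu_{\eta_0}}(t_2)$. Let $V_{\eta_0}$ be the derivative matrix at $\eta=\eta_0$ of $\eta\mapsto\mathsf E(\psi_\eta(X))$. The covariance is $$\begin{aligned}\tilde{\mathcal C}_{(\omega_1,t_1),(\omega_2,t_2)}&=\mathcal C_{(\omega_1,t_1),(\omega_2,t_2)}+\dot F_{\omega_2}^{\eta_0}(t_2)^\top V_{\eta_0}^{-1}\mathsf E\big(y_{\omega_1,t_1}(X)\psi_{\eta_0}(X)\big)+\dot F_{\omega_1}^{\eta_0}(t_1)^\top V_{\eta_0}^{-1}\mathsf E\big(y_{\omega_2,t_2}(X)\psi_{\eta_0}(X)\big)\\&\quad+\dot F_{\omega_1}^{\eta_0}(t_1)^\top V_{\eta_0}^{-1}\mathsf E\big(\psi_{\eta_0}(X)\psi_{\eta_0}(X)^\top\big)(V_{\eta_0}^{-1})^\top\dot F_{\omega_2}^{\eta_0}(t_2).\end{aligned}$$ It is the covariance of the weak limit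 of $\sqrt n(F_{n,\omega}(t)-F_\omega^{\mu_{\hat\eta}}(t))$, with $F_{n,\omega}$ the empirical distance profile and $\hat\eta$ the maximum likelihood estimator. $A$ is the log-normalizer, so that $\int p_\eta\,\mathrm d\nu=1$. *)

(* Defs.v *)
From HB Require Import structures.
From mathcomp Require Import all_boot all_order all_algebra.
From mathcomp Require Import all_classical all_reals all_analysis.

Set Implicit Arguments.
Unset Strict Implicit.
Unset Printing Implicit Defensive.

Import Order.TTheory GRing.Theory Num.Theory.
Import numFieldNormedType.Exports.

Local Open Scope classical_set_scope.
Local Open Scope ring_scope.

(* No compatibility between the metric and the sigma-algebra is built into this
   structure; it is imposed separately by [borel_space]. *)
#[short(type="measurableMetricType")]
HB.structure Definition MeasurableMetric (d : measure_display)
  (R : numDomainType) := { M of Metric R M & Measurable d M }.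

Definition borel_space (d : measure_display) (R : numDomainType)
    (Om : measurableMetricType d R) : Prop :=
  (measurable : set (set Om)) = <<s [set U : set Om | open U] >>.

Definition separable_space (T : topologicalType) : Prop :=
  exists2 D : set T, countable D & dense D.

Section derivatives.
Context {R : realType} {p : nat}.
Implicit Types eta : 'cV[R]_p.

Definition partial (i : 'I_p) (f : 'cV[R]_p -> R) eta : R :=
  'D_(delta_mx i 0) f eta.

Definition grad (f : 'cV[R]_p -> R) eta : 'cV[R]_p :=
  \col_i partial i f eta.

Definition hessian (f : 'cV[R]_p -> R) eta : 'M[R]_p :=
  \matrix_(i, j) partial i (partial j f) eta.

Definition derivative_matrix (m : nat) (g : 'cV[R]_p -> 'cV[R]_m) eta :
    'M[R]_(m, p) :=
  \matrix_(i, j) partial j (fun eta' => g eta' i 0) eta.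

End derivatives.

Section expectation.
Context {d : measure_display} {S : measurableType d} {R : realType}.

Definition expectation_mx (P : probability S R) (m n : nat)
    (Z : S -> 'M[R]_(m, n)) : 'M[R]_(m, n) :=
  \matrix_(i, j) fine 'E_P[fun s => Z s i j].

End expectation.

Section exponential_family.
Context {d : measure_display} {R : realType} {Om : measurableMetricType d R}
  {p : nat}.

Definition exp_density (h : Om -> R) (T : Om -> 'cV[R]_p) (A : 'cV[R]_p -> R)
    (eta : 'cV[R]_p) (x : Om) : R :=
  h x * expR ((eta^T *m T x) 0 0 - A eta).

Definition score (T : Om -> 'cV[R]_p) (A : 'cV[R]_p -> R) (eta : 'cV[R]_p)
    (x : Om) : 'cV[R]_p :=
  T x - grad A eta.

End exponential_family.

Section composite_null_covariance.
Context {d : measure_display} {R : realType} {Om : measurableMetricType d R}.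

Definition distance_profile (m : probability Om R) (w : Om) (t : R) : R :=
  fine (m [set x | mdist w x <= t]).

Definition ball_indicator (w : Om) (t : R) (x : Om) : R :=
  \1_[set z | mdist w z <= t] x.

Context {d' : measure_display} {S : measurableType d'} {p : nat}.

Definition distance_profile_dot (mu : 'cV[R]_p -> probability Om R)
    (eta0 : 'cV[R]_p) (w : Om) (t : R) : 'cV[R]_p :=
  grad (fun eta => distance_profile (mu eta) w t) eta0.

(* covariance of the Gaussian limit under the simple null hypothesis *)
Definition simple_cov (P : probability S R) (X : S -> Om)
    (m : probability Om R) (w1 : Om) (t1 : R) (w2 : Om) (t2 : R) : R :=
  fine (P [set s | mdist w1 (X s) <= t1 /\ mdist w2 (X s) <= t2])
  - distance_profile m w1 t1 * distance_profile m w2 t2.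

(* covariance of the Gaussian limit under the composite null hypothesis, for an
   arbitrary parametric family [mu] and estimating function [psi] *)
Definition composite_cov (P : probability S R) (X : S -> Om)
    (mu : 'cV[R]_p -> probability Om R) (psi : 'cV[R]_p -> Om -> 'cV[R]_p)
    (eta0 : 'cV[R]_p) (w1 : Om) (t1 : R) (w2 : Om) (t2 : R) : R :=
  let V := derivative_matrix
             (fun eta => expectation_mx P (fun s => psi eta (X s))) eta0 in
  let Fdot := distance_profile_dot mu eta0 in
  let Eypsi w t :=
    expectation_mx P (fun s => ball_indicator w t (X s) *: psi eta0 (X s)) in
  let Epsipsi :=
    expectation_mx P (fun s => psi eta0 (X s) *m (psi eta0 (X s))^T) in
  simple_cov P X (mu eta0) w1 t1 w2 t2
  + ((Fdot w2 t2)^T *m invmx V *m Eypsi w1 t1) 0 0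
  + ((Fdot w1 t1)^T *m invmx V *m Eypsi w2 t2) 0 0
  + ((Fdot w1 t1)^T *m invmx V *m Epsipsi *m (invmx V)^T *m Fdot w2 t2) 0 0.

End composite_null_covariance.

(* Main.v *)
Require Import Defs.
From HB Require Import structures.
From mathcomp Require Import all_boot all_order all_algebra.
From mathcomp Require Import all_classical all_reals all_analysis.
From mathcomp Require Import measurable_realfun ring lra.

Set Implicit Arguments.
Unset Strict Implicit.
Unset Printing Implicit Defensive.

Import Order.TTheory GRing.Theory Num.Theory.
Import numFieldNormedType.Exports.

Local Open Scope classical_set_scope.
Local Open Scope ring_scope.

(** Three identities of exponential family theory make the three correction
terms of the composite covariance multiples of one quadratic form.  Write
[I] for the Hessian of [A] at [eta0] and [a], [b] for the gradients at [eta0]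
of the two distance profiles.

- The derivative matrix [V] of the expected score is [- I], because the score
  depends on the parameter only through the gradient of [A].
- The second moment matrix of the score at [eta0] is [I]: the Hessian of the
  log-normalizer is the covariance matrix of the sufficient statistic
  ([is_derive_partial_log_normalizer]).
- The mean of the score over the event that [X] falls in a ball is the
  gradient of the probability of that ball ([is_derive_tilted_mean]).

Hence each of the two cross terms is [- a^T I^-1 b], the sandwich term is
[a^T I^-1 b], and the sum is [- a^T I^-1 b] ([composite_quadratic_form]).

The analytic content is differentiation under the integral sign.  Everything
is transported to the probability space of [X]: with [U = T \o X],
the density formula gives
  [mu eta B = exp (A eta0 - A eta) * E (1_B(X) exp ((eta - eta0)^T U))]
([mu_exp_integral]), so that with [B] the whole space
[A eta - A eta0 = ln E (exp ((eta - eta0)^T U))], and the probability of [B]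
is a quotient of two integrals of the shape
[E (f exp ((eta - eta0)^T U))].  Such an integral has partial derivatives
obtained by multiplying [f] by a coordinate of [U]
([is_derive_exp_integral]), as soon as it converges for every [eta] in the
open set [H].  That convergence condition is itself preserved when [f] is
multiplied by a coordinate of [U] ([exp_integrable_mul_stat]), so the rule can
be applied twice and yields the second derivatives as well. *)

(** * Directional derivatives of logarithms and quotients *)

(** Reduces directional derivatives to derivatives on the line, where the chain
rule and differentiation under the integral sign are available. *)
Lemma is_derive_lineP (R : realType) (V : normedModType R) (f : V -> R)
    (a v : V) (df : R) :
  is_derive a v f df <-> is_derive (0 : R) 1 (fun s : R => f (s *: v + a)) df.
Proof.
have E : (fun h : R => h^-1 *: (f (h *: v + a) - f a)) =
    (fun h : R => h^-1 *: (f ((h *: (1 : R) + 0) *: v + a) - f (0 *: v + a))).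
  by apply/funext => h; rewrite scale0r add0r addr0 [h *: 1]mulr1.
split=> -[f1 f2]; apply: DeriveDef.
- by move: f1; rewrite /derivable E.
- by move: f2; rewrite /derive E.
- by rewrite /derivable E.
- by rewrite /derive E.
Qed.

Lemma is_derive_ln_comp (R : realType) (V : normedModType R) (f : V -> R)
    (a v : V) (df : R) : 0 < f a ->
  is_derive a v f df -> is_derive a v (fun x => ln (f x)) (df / f a).
Proof.
move=> fa0 /is_derive_lineP dfa; apply/is_derive_lineP.
have fE : f (0 *: v + a) = f a by rewrite scale0r add0r.
have dln : is_derive (f (0 *: v + a)) 1 (@ln R) (f a)^-1.
  by rewrite fE; exact: is_derive1_ln.
by rewrite mulrC; exact: is_derive1_comp.
Qed.

Lemma is_derive_quotient (R : realType) (V : normedModType R) (f g : V -> R)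
    (a v : V) (df dg : R) : g a != 0 ->
  is_derive a v f df -> is_derive a v g dg ->
  is_derive a v (fun x => f x / g x) (df / g a - f a * dg / g a ^+ 2).
Proof.
move=> ga0 /is_derive_lineP dfa /is_derive_lineP dga; apply/is_derive_lineP.
have ga0' : g (0 *: v + a) != 0 by rewrite scale0r add0r.
have dV := is_deriveV ga0' dga.
apply: is_derive_eq.
rewrite !scale0r !add0r -[_ *: (_ *: _)]/(_ * (_ * _)) -[_ *: df]/(_ * df).
by field.
Qed.

(** * Differentiation of exponential integrals *)

Lemma expR_abs_le (R : realType) (a : R) : expR `|a| <= expR a + expR (- a).
Proof.
by case: (ler0P a) => _; rewrite ?lerDl ?lerDr expR_ge0.
Qed.

Lemma abs_le_expR (R : realType) (e a : R) :
  0 < e -> `|a| <= e^-1 * expR (e * `|a|).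
Proof.
move=> e0; rewrite ler_pdivlMl//.
by apply: (le_trans _ (expR_ge1Dx _)); rewrite lerDr.
Qed.

Section exponential_integral_line.
Context d (S : measurableType d) (R : realType) (m : {measure set S -> \bar R}).

(** For [`|r| <= e / 2] the derivative [g * u * exp (r * u)] of the integrand is
dominated by a multiple of [g * exp (e * `|u|)]: one half of the exponent
bounds [exp (r * u)], the other half absorbs the factor [u]. *)
Lemma is_derive_exponential_line (g u : S -> R) (e : R) : 0 < e ->
  measurable_fun setT g -> measurable_fun setT u ->
  m.-integrable setT (EFin \o (fun s => g s * expR (e * `|u s|))) ->
  is_derive (0 : R) 1 (fun r : R => \int[m]_s (g s * expR (r * u s)))%R
    (\int[m]_s (g s * u s))%R.
Proof.
move=> e0 mg mu intg.
pose f (r : R) s := g s * expR (r * u s).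
have mf r : measurable_fun setT (f r).
  apply: measurable_funM => //; apply: measurableT_comp => //.
  exact: measurable_funM.
have df (r : R) s : is_derive r 1 (f ^~ s) (g s * (expR (r * u s) * u s)).
  have d1 : is_derive r 1 (fun r : R => r * u s) (u s).
    by apply: is_derive_eq; rewrite scaler0 add0r [_ *: _]mulr1.
  have d2 : is_derive r 1 (fun r : R => expR (r * u s)) (expR (r * u s) * u s).
    exact: (@is_derive1_comp R expR (fun r : R => r * u s)).
  exact: (is_deriveZ (g s) d2).
have d1f r s : partial1of2 f r s = g s * (expR (r * u s) * u s).
  by rewrite partial1of2E; case: (df r s).
have I0 : `]- (e / 2), e / 2[%classic (0 : R).
  by rewrite /= in_itv/= oppr_lt0 andbb divr_gt0.
have leI (r : R) s : `]- (e / 2), e / 2[%classic r -> r * u s <= e / 2 * `|u s|.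
  rewrite /= in_itv/= -ltr_norml => /ltW re.
  by rewrite (le_trans (ler_norm _))// normrM ler_wpM2r.
have intf r : `]- (e / 2), e / 2[%classic r -> m.-integrable setT (EFin \o f r).
  move=> Ir; apply: le_integrable intg => //; first exact/measurable_EFinP.
  move=> s _; rewrite lee_fin !normrM ler_wpM2l// !(ger0_norm (expR_ge0 _)).
  by rewrite ler_expR (le_trans (leI _ s Ir))// ler_wpM2r//; lra.
pose G s := (e / 2)^-1 * `|g s * expR (e * `|u s|)|.
have G0 s : 0 <= G s by rewrite mulr_ge0// invr_ge0 divr_ge0// ltW.
have intG : m.-integrable setT (EFin \o G).
  rewrite (_ : EFin \o G =
    (fun s => (e / 2)^-1%:E * `|(g s * expR (e * `|u s|))%:E|)%E)//.
  by apply: integrableZl => //; exact: integrable_abse.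
have Gub r s : `]- (e / 2), e / 2[%classic r -> setT s ->
    `|partial1of2 f r s| <= G s.
  move=> Ir _; rewrite d1f /G !normrM [leRHS]mulrCA ler_wpM2l//.
  rewrite !(ger0_norm (expR_ge0 _)).
  have -> : e * `|u s| = e / 2 * `|u s| + e / 2 * `|u s| by lra.
  rewrite expRD [leRHS]mulrCA ler_pM ?expR_ge0//; first by rewrite ler_expR leI.
  by apply: abs_le_expR; lra.
have derf r s : `]- (e / 2), e / 2[%classic r -> setT s -> derivable (f ^~ s) r 1.
  by move=> _ _; case: (df r s).
have := derivable_under_integral measurableT I0 intf derf G0 intG Gub.
have := differentiation_under_integral measurableT I0 intf derf G0 intG Gub.
rewrite derive1E => D1 D2; apply: DeriveDef => //; rewrite D1.
by apply: eq_Rintegral => s _; rewrite d1f mul0r expR0 mul1r.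
Qed.

End exponential_integral_line.

Section exponential_integral.
Context d (S : measurableType d) (R : realType) (m : {measure set S -> \bar R}).
Context (p : nat) (U : S -> 'cV[R]_p) (H : set 'cV[R]_p) (eta0 : 'cV[R]_p).
Hypotheses (hH : open H) (mU : forall i, measurable_fun setT (fun s => U s i 0)).

(** Exponential weights are centred at [eta0], so that they equal 1 at the
parameter where the derivatives are eventually taken. *)
Definition tilt (eta : 'cV[R]_p) (s : S) : R :=
  expR (((eta - eta0)^T *m U s) 0 0).

Definition exp_integral (f : S -> R) (eta : 'cV[R]_p) : R :=
  (\int[m]_s (f s * tilt eta s))%R.

(** Convergence on all of [H], rather than at one parameter, supplies the
dominating functions: an open set leaves room around each of its points. *)
Definition exp_integrable (f : S -> R) : Prop :=
  measurable_fun setT f /\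
  forall eta, H eta -> m.-integrable setT (EFin \o (fun s => f s * tilt eta s)).

Lemma tilt0 s : tilt eta0 s = 1.
Proof. by rewrite /tilt subrr trmx0 mul0mx mxE expR0. Qed.

Lemma measurable_tilt eta : measurable_fun setT (tilt eta).
Proof.
apply: measurableT_comp => //; under eq_fun do rewrite mxE.
by apply: measurable_sum => i; exact: measurable_funM.
Qed.

Lemma tilt_line (r : R) i eta s :
  tilt (r *: delta_mx i 0 + eta) s = tilt eta s * expR (r * U s i 0).
Proof.
rewrite /tilt -addrA addrC linearD/= mulmxDl mxE expRD; congr (_ * expR _).
by rewrite linearZ/= -scalemxAl mxE trmx_delta -rowE mxE.
Qed.

Lemma open_segment eta i : H eta ->
  exists2 e : R, 0 < e & forall r : R, `|r| <= e -> H (r *: delta_mx i 0 + eta).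
Proof.
move=> Heta.
have : (fun r : R => r *: delta_mx i 0 + eta) @ (0 : R) -->
    (0 : R) *: delta_mx i 0 + eta.
  by apply: cvgD; [apply: cvgZ; [exact: cvg_id|exact: cvg_cst]|exact: cvg_cst].
rewrite scale0r add0r => cl.
have /cl[e /= e0 He] : nbhs eta H by exact: open_nbhs_nbhs.
exists (e / 2); first by rewrite divr_gt0.
move=> r re; apply: He; rewrite /= sub0r normrN (le_lt_trans re)//.
by rewrite ltr_pdivrMr// ltr_pMr// ltr1n.
Qed.

(** Since [H] is open, both [eta + e *: e_i] and [eta - e *: e_i] lie in [H] for
some [e > 0], and the sum of the two tilts there dominates the tilt at [eta]
times [exp (e * `|U_i|)]. *)
Lemma exp_integrable_expR_abs f eta i : exp_integrable f -> H eta ->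
  exists2 e : R, 0 < e & m.-integrable setT
    (EFin \o (fun s => f s * tilt eta s * expR (e * `|U s i 0|))).
Proof.
move=> [mf intf] /(open_segment i)[e e0 He]; exists e => //.
have mt := measurable_tilt.
have /intf i1 : H (e *: delta_mx i 0 + eta) by apply: He; rewrite gtr0_norm.
have /intf i2 : H (- e *: delta_mx i 0 + eta).
  by apply: He; rewrite normrN gtr0_norm.
apply: le_integrable (integrableD measurableT (integrable_abse i1)
  (integrable_abse i2)) => //.
  apply/measurable_EFinP/measurable_funM; first exact: measurable_funM.
  apply: measurableT_comp => //; apply: measurable_funM => //.
  exact: measurableT_comp.
move=> s _ /=; rewrite lee_fin [leRHS]ger0_norm; last by rewrite addr_ge0.
rewrite !tilt_line !mulrA !normrM -mulrDr ler_wpM2l ?mulr_ge0//.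
rewrite !(ger0_norm (expR_ge0 _)).
have -> : e * `|U s i 0| = `|e * U s i 0| by rewrite normrM (gtr0_norm e0).
by rewrite mulNr expR_abs_le.
Qed.

(** The factor [U_i] is absorbed by the exponential room left by
[exp_integrable_expR_abs].  This closure property is what allows repeated
differentiation under the integral sign. *)
Lemma exp_integrable_mul_stat f i :
  exp_integrable f -> exp_integrable (fun s => f s * U s i 0).
Proof.
move=> tf; have [mf _] := tf; split; first exact: measurable_funM.
move=> eta /(exp_integrable_expR_abs i tf)[e e0 intf].
have := @integrableZl _ _ _ m setT measurableT e^-1 _ intf.
apply: le_integrable => //.
  apply/measurable_EFinP/measurable_funM; first exact: measurable_funM.
  exact: measurable_tilt.
move=> s _ /=; rewrite lee_fin mulrAC !normrM [leRHS]mulrCA ler_wpM2l//.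
by rewrite (ger0_norm (expR_ge0 _)) normfV (gtr0_norm e0) abs_le_expR.
Qed.

Lemma is_derive_exp_integral f eta i : exp_integrable f -> H eta ->
  is_derive eta (delta_mx i 0) (exp_integral f)
    (exp_integral (fun s => f s * U s i 0) eta).
Proof.
move=> tf Heta; have [e e0 intf] := exp_integrable_expR_abs i tf Heta.
have [mf _] := tf.
have mg : measurable_fun setT (fun s => f s * tilt eta s).
  by apply: measurable_funM => //; exact: measurable_tilt.
apply/is_derive_lineP.
have := is_derive_exponential_line e0 mg (mU i) intf.
rewrite /exp_integral.
under [X in is_derive _ _ X _]eq_fun do
  under eq_Rintegral do rewrite -mulrA -tilt_line.
by under eq_Rintegral do rewrite mulrAC.
Qed.

End exponential_integral.

(** * Integration against a measure given by a density *)

Section change_of_measure.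
Context d (T : measurableType d) (R : realType).
Variables (mu nu : {measure set T -> \bar R}) (g : T -> R).
Hypotheses (mg : measurable_fun setT g) (g0 : forall x, 0 <= g x).
Hypothesis mug : forall B, measurable B -> mu B = (\int[nu]_(x in B) (g x)%:E)%E.

Import HBNNSimple.
Local Open Scope ereal_scope.

(** [nu] may fail to be sigma-finite, so the formula is proved from simple
functions by monotone convergence rather than through a Radon-Nikodym
derivative. *)
Lemma ge0_integral_density (f : T -> \bar R) :
  measurable_fun setT f -> (forall x, 0 <= f x) ->
  \int[mu]_x f x = \int[nu]_x (f x * (g x)%:E).
Proof.
move=> mf f0.
pose h := nnsfun_approx measurableT mf.
have hf x : (EFin \o h n) x @[n --> \oo] --> f x.
  by apply: cvg_nnsfun_approx.
have hnd x : {homo (fun n => (h n x)%:E) : a b / (a <= b)%N >-> a <= b}.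
  by move=> a b ab; rewrite lee_fin; exact/lefP/nd_nnsfun_approx.
transitivity (limn (fun n => \int[mu]_x (h n x)%:E)).
  rewrite -monotone_convergence//.
  - by apply: eq_integral => x _; apply/esym/cvg_lim => //; exact: hf.
  - by move=> n; exact/measurable_EFinP.
  - by move=> n x _; rewrite lee_fin.
transitivity (limn (fun n => \int[nu]_x ((h n x)%:E * (g x)%:E))); last first.
  rewrite -monotone_convergence//.
  - apply: eq_integral => x _; apply/cvg_lim => //.
    by apply: cvgeZr => //; exact: hf.
  - by move=> n; apply/measurable_EFinP/measurable_funM.
  - by move=> n x _; rewrite mule_ge0 ?lee_fin.
  - by move=> x _ a b ab; rewrite lee_wpmul2r ?lee_fin//; exact: hnd.
congr (limn _); apply/funext => n.
rewrite integralT_nnsfun sintegralE.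
under [RHS]eq_integral => x _.
  rewrite fimfunE -fsumEFin// ge0_mule_fsuml; last first.
    by move=> y; exact: nnfun_muleindic_ge0.
  over.
have mind r : measurable_fun setT (\1_(h n @^-1` [set r]) : T -> R).
  by apply: measurable_indic; exact: measurable_funPTI.
rewrite ge0_integral_fsum//; last 2 first.
- move=> y; apply/measurable_EFinP/measurable_funM => //.
  exact: measurable_funM.
- by move=> y x _; rewrite mule_ge0 ?lee_fin// -lee_fin nnfun_muleindic_ge0.
apply: eq_fsbigr => r /[!inE] -[x _ <-].
under eq_integral do rewrite EFinM -muleA.
rewrite ge0_integralZl//; last 3 first.
- by apply/measurable_EFinP/measurable_funM.
- by move=> y _; rewrite mule_ge0 ?lee_fin.
- by rewrite lee_fin.
rewrite mug//.
rewrite integral_mkcond; congr (_ * _); apply: eq_integral => y _.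
rewrite patchE indicE; case: ifP => _; by rewrite ?mul1e ?mul0e.
Qed.

End change_of_measure.

(** * Measurability of closed balls *)

Section closed_balls.
Context d (R : realType) (Om : measurableMetricType d R).

Lemma measurable_mdist_le : borel_space Om ->
  forall (w : Om) t, measurable [set x : Om | mdist w x <= t].
Proof.
move=> hB w t.
have -> : [set x : Om | mdist w x <= t] = ~` [set x | t < mdist w x].
  by apply/funext => x; apply/propext; rewrite /setC/= leNgt; split => /negP.
apply: measurableC; rewrite hB; apply: sub_gen_smallest => /=.
rewrite openE => x /= tx; apply/nbhs_ballP.
exists (mdist w x - t); first by rewrite /= subr_gt0.
move=> y; rewrite ballEmdist/= => xy.
have := metric_triangle w y x; rewrite (metric_sym y x); lra.
Qed.

End closed_balls.

(** * The log-normalizer generates the moments of the statistic *)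

Section log_normalizer.
Context d (S : measurableType d) (R : realType) (P : probability S R).
Context (p : nat) (U : S -> 'cV[R]_p) (H : set 'cV[R]_p) (eta0 : 'cV[R]_p).
Hypotheses (hH : open H) (Heta0 : H eta0).
Hypothesis mU : forall i, measurable_fun setT (fun s => U s i 0).
Hypothesis exp_int1 : exp_integrable P U H eta0 (cst 1).

Local Notation W := (exp_integral P U eta0).
Local Notation Z := (exp_integral P U eta0 (cst 1)).

Let mean (i : 'I_p) : R := (\int[P]_s U s i 0)%R.

Lemma exp_integral_at0 (f : S -> R) : W f eta0 = (\int[P]_s f s)%R.
Proof. by apply: eq_Rintegral => s _; rewrite tilt0 mulr1. Qed.

Lemma Rintegral_prob_cst (r : R) : (\int[P]_s r)%R = r.
Proof.
rewrite Rintegral_cst//.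
transitivity (r * fine (1 : \bar R)); last exact: mulr1.
by congr (_ * fine _); exact: probability_setT.
Qed.

Lemma exp_integral1_at0 : Z eta0 = 1.
Proof.
by rewrite exp_integral_at0 Rintegral_prob_cst.
Qed.

Lemma exp_integrable_integrable (f : S -> R) : exp_integrable P U H eta0 f ->
  P.-integrable setT (EFin \o f).
Proof.
move=> [_ /(_ _ Heta0)]; congr (P.-integrable _ _).
by apply/funext => s; rewrite /= tilt0 mulr1.
Qed.

Lemma exp_integrable_stat i : exp_integrable P U H eta0 (fun s => U s i 0).
Proof.
have := exp_integrable_mul_stat hH mU i exp_int1.
by under [X in exp_integrable _ _ _ _ X]eq_fun do rewrite mul1r.
Qed.

Lemma integral_centred (b : S -> R) i : exp_integrable P U H eta0 b ->
  (\int[P]_s (b s * (U s i 0 - mean i)) =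
   \int[P]_s (b s * U s i 0) - (\int[P]_s b s) * mean i)%R.
Proof.
move=> tb; have ib := exp_integrable_integrable tb.
have ibU := exp_integrable_integrable (exp_integrable_mul_stat hH mU i tb).
under eq_Rintegral do rewrite mulrBr.
rewrite RintegralB//; first by rewrite RintegralZr.
exact: (integrableZr measurableT (mean i) ib).
Qed.

(** The quotient is the mean of [b] under the tilted law; its derivative is the
covariance of [b] with the statistic.  Indicators for [b] give the derivative
of a probability, and coordinates of [U] give the Hessian of [A]. *)
Lemma is_derive_tilted_mean (b : S -> R) i : exp_integrable P U H eta0 b ->
  is_derive eta0 (delta_mx i 0) (fun eta => W b eta / Z eta)
    (\int[P]_s (b s * (U s i 0 - mean i)))%R.
Proof.
move=> tb.
have db := is_derive_exp_integral hH mU i tb Heta0.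
have dZ := is_derive_exp_integral hH mU i exp_int1 Heta0.
have Z0 : Z eta0 != 0 by rewrite exp_integral1_at0 oner_eq0.
apply: is_derive_eq (is_derive_quotient Z0 db dZ) _.
rewrite exp_integral1_at0 expr1n !divr1 !exp_integral_at0 integral_centred//.
by congr (_ - _ * _); apply: eq_Rintegral => s _; rewrite mul1r.
Qed.

Context (A : 'cV[R]_p -> R).
Hypothesis expA : forall eta, H eta -> expR (A eta - A eta0) = Z eta.

(** Stated on all of [H], not only at [eta0], because it is differentiated once
more. *)
Lemma partial_log_normalizer i eta : H eta ->
  partial i A eta = W (fun s => U s i 0) eta / Z eta.
Proof.
move=> Heta; have dZ := is_derive_exp_integral hH mU i exp_int1 Heta.
have Z0 : 0 < Z eta by rewrite -expA// expR_gt0.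
have dl := is_deriveD (is_derive_cst (A eta0) eta (delta_mx i 0))
  (is_derive_ln_comp Z0 dZ).
have : is_derive eta (delta_mx i 0) A (W (fun s => U s i 0) eta / Z eta).
  apply: near_eq_is_derive; last first.
    apply: is_derive_eq dl _; rewrite add0r; congr (_ / _).
    by apply: eq_Rintegral => s _; rewrite mul1r.
  have : nbhs eta H by exact: open_nbhs_nbhs.
  apply: filterS => eta' Heta'.
  by rewrite fctE -expA// expRK addrC subrK.
by case.
Qed.

Lemma partial_log_normalizer_at0 i : partial i A eta0 = mean i.
Proof.
by rewrite partial_log_normalizer// exp_integral1_at0 divr1 exp_integral_at0.
Qed.

(** Near [eta0] the partial derivative of [A] is the tilted mean of [U_j]. *)
Lemma is_derive_partial_log_normalizer i j :
  is_derive eta0 (delta_mx i 0) (partial j A)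
    (\int[P]_s ((U s i 0 - mean i) * (U s j 0 - mean j)))%R.
Proof.
apply: near_eq_is_derive.
  have : nbhs eta0 H by exact: open_nbhs_nbhs.
  by apply: filterS => eta Heta; rewrite partial_log_normalizer.
apply: is_derive_eq (is_derive_tilted_mean i (exp_integrable_stat j)) _.
have iU k : P.-integrable setT (EFin \o (fun s => U s k 0 - mean k)).
  have := integrableB measurableT
    (exp_integrable_integrable (exp_integrable_stat k))
    (finite_measure_integrable_cst P (mean k) measurableT).
  by [].
have iUU : P.-integrable setT
    (EFin \o (fun s => U s j 0 * (U s i 0 - mean i))).
  have := integrableB measurableT
    (exp_integrable_integrable
      (exp_integrable_mul_stat hH mU i (exp_integrable_stat j)))
    (integrableZr measurableT (mean i)
      (exp_integrable_integrable (exp_integrable_stat j))).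
  congr (P.-integrable _ _); apply/funext => s /=.
  by rewrite mulrBr.
have mean0 : (\int[P]_s (U s i 0 - mean i))%R = 0.
  rewrite RintegralB//; last 2 first.
  - exact: exp_integrable_integrable (exp_integrable_stat i).
  - exact: finite_measure_integrable_cst.
  by rewrite Rintegral_prob_cst subrr.
(* The derivative comes with [U_j] uncentred; centring it changes nothing, as
   [U_i - mean i] has mean zero. *)
rewrite [RHS](_ : _ = \int[P]_s (U s j 0 * (U s i 0 - mean i) -
    mean j * (U s i 0 - mean i)))%R; last first.
  by apply: eq_Rintegral => s _; ring.
rewrite RintegralB//; last exact: (integrableZl measurableT (mean j) (iU i)).
by rewrite RintegralZl// mean0 mulr0 subr0.
Qed.

End log_normalizer.

(** * Exponential families as exponential integrals on the sample space *)

Section exponential_family_law.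
Context (d : measure_display) (R : realType) (Om : measurableMetricType d R).
Context (p : nat) (nu : {measure set Om -> \bar R}) (H : set 'cV[R]_p).
Context (h : Om -> R) (T : Om -> 'cV[R]_p) (A : 'cV[R]_p -> R).
Context (mu : 'cV[R]_p -> probability Om R) (eta0 : 'cV[R]_p).
Hypotheses (h_meas : measurable_fun setT h) (h_ge0 : forall x, 0 <= h x).
Hypothesis T_meas : forall i, measurable_fun setT (fun x => T x i 0).
Hypothesis mu_density : forall eta, H eta -> forall B : set Om, measurable B ->
  mu eta B = (\int[nu]_(x in B) (exp_density h T A eta x)%:E)%E.
Hypothesis heta0 : H eta0.
Context (d' : measure_display) (S : measurableType d') (P : probability S R).
Context (X : {RV P >-> Om}).
Hypothesis X_law : forall B : set Om, measurable B ->
  distribution P X B = mu eta0 B.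

Local Notation W := (exp_integral P (T \o X) eta0).

Lemma measurable_exp_density eta : measurable_fun setT (exp_density h T A eta).
Proof.
apply: measurable_funM => //; apply: measurableT_comp => //.
apply: measurable_funB => //; under eq_fun do rewrite mxE.
by apply: measurable_sum => i; exact: measurable_funM.
Qed.

Lemma exp_density_ge0 eta x : 0 <= exp_density h T A eta x.
Proof. by rewrite mulr_ge0// expR_ge0. Qed.

Lemma exp_density_tilt eta x : exp_density h T A eta x =
  tilt T eta0 eta x * expR (A eta0 - A eta) * exp_density h T A eta0 x.
Proof.
rewrite /exp_density /tilt -expRD mulrCA -expRD; congr (_ * expR _).
have -> : ((eta - eta0)^T *m T x) 0 0 =
    (eta^T *m T x) 0 0 - (eta0^T *m T x) 0 0.
  by rewrite [(eta - eta0)^T]linearB/= mulmxBl !mxE.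
by ring.
Qed.

(** The density at [eta] is that at [eta0] times the normalized tilt, so [mu eta]
has the normalized tilt as density with respect to [mu eta0], the law of
[X]. *)
Lemma mu_tilt eta (B : set Om) : H eta -> measurable B ->
  mu eta B =
  (\int[P]_s (\1_B (X s) * tilt (T \o X) eta0 eta s *
    expR (A eta0 - A eta))%:E)%E.
Proof.
move=> Heta mB.
have mt : measurable_fun setT
    (fun x => \1_B x * tilt T eta0 eta x * expR (A eta0 - A eta)).
  apply: measurable_funM => //; apply: measurable_funM => //.
  exact: measurable_tilt.
have t0 x : (0 <= (\1_B x * tilt T eta0 eta x * expR (A eta0 - A eta))%:E)%E.
  by rewrite lee_fin !mulr_ge0// ?expR_ge0.
have me : measurable_fun setT
    (fun x => (\1_B x * tilt T eta0 eta x * expR (A eta0 - A eta))%:E).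
  exact/measurable_EFinP.
transitivity (\int[mu eta0]_x
    (\1_B x * tilt T eta0 eta x * expR (A eta0 - A eta))%:E)%E; last first.
  transitivity (\int[distribution P X]_x
    (\1_B x * tilt T eta0 eta x * expR (A eta0 - A eta))%:E)%E.
    by apply: eq_measure_integral => C mC _; exact/esym/X_law.
  by rewrite ge0_integral_distribution.
rewrite (ge0_integral_density (measurable_exp_density eta0)
  (exp_density_ge0 eta0) (mu_density heta0))//.
rewrite mu_density// [LHS]integral_mkcond; apply: eq_integral => x _.
rewrite patchE indicE; case: ifP => _; last by rewrite !mul0r mul0e.
by rewrite mul1r -EFinM -exp_density_tilt.
Qed.

Lemma measurable_stat_comp i : measurable_fun setT (fun s => (T \o X) s i 0).
Proof. exact: measurableT_comp (T_meas i) _. Qed.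

(** Integrability for every [eta] in [H] is automatic: up to the normalizing
constant the integral is the probability [mu eta B]. *)
Lemma exp_integrable_indicator (B : set Om) : measurable B ->
  exp_integrable P (T \o X) H eta0 (fun s => \1_B (X s)).
Proof.
move=> mB; have mBX : measurable_fun setT (fun s => \1_B (X s) : R).
  exact: measurableT_comp.
split=> // eta Heta; pose c := expR (A eta0 - A eta).
have mt := measurable_tilt eta0 measurable_stat_comp eta.
have intc : P.-integrable setT
    (EFin \o (fun s => \1_B (X s) * tilt (T \o X) eta0 eta s * c)).
  apply/integrableP; split.
    by apply/measurable_EFinP/measurable_funM => //; exact: measurable_funM.
  under eq_integral => s _.
    rewrite gee0_abs; last by rewrite lee_fin !mulr_ge0// expR_ge0.
    over.
  by rewrite -mu_tilt// -ge0_fin_numE// fin_num_measure.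
have := integrableZr measurableT c^-1 intc.
congr (P.-integrable _ _); apply/funext => s /=.
by rewrite -EFinM mulfK// gt_eqF// expR_gt0.
Qed.

Lemma mu_exp_integral eta (B : set Om) : H eta -> measurable B ->
  fine (mu eta B) = expR (A eta0 - A eta) * W (fun s => \1_B (X s)) eta.
Proof.
move=> Heta mB; have [_ /(_ _ Heta) intB] := exp_integrable_indicator mB.
rewrite mu_tilt//; rewrite -RintegralZl//.
by rewrite /Rintegral; congr fine; apply: eq_integral => s _; rewrite mulrC.
Qed.

End exponential_family_law.

(** * The covariance of the limit process *)

Lemma composite_quadratic_form (R : realType) p (I V M : 'M[R]_p)
    (a b x y : 'cV[R]_p) (c : R) :
  I \in unitmx -> I^T = I -> V = - I -> M = I -> x = a -> y = b ->
  c + (b^T *m invmx V *m x) 0 0 + (a^T *m invmx V *m y) 0 0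
    + (a^T *m invmx V *m M *m (invmx V)^T *m b) 0 0
  = c - (a^T *m invmx I *m b) 0 0.
Proof.
move=> uI sI -> -> -> ->.
have iN : invmx (- I) = - invmx I.
  rewrite -scaleN1r invmxZ ?invrN1 ?scaleN1r//.
  by rewrite -scaleN1r unitmxZ// unitrN1.
have sb : (b^T *m invmx I *m a) 0 0 = (a^T *m invmx I *m b) 0 0.
  rewrite -[in LHS](trmxK (b^T *m invmx I *m a)) mxE.
  by rewrite !trmx_mul trmxK trmx_inv sI mulmxA.
rewrite iN [(- _)^T]linearN/= trmx_inv sI.
rewrite !(mulmxN, mulNmx) ?opprK mulmxKV//.
have N (Q : 'M[R]_1) : (- Q) 0 0 = - Q 0 0 by rewrite mxE.
by rewrite !N sb subrK.
Qed.

Theorem proposition4p3 (R : realType) (d : measure_display)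
    (Om : measurableMetricType d R)
    (hsep : separable_space Om) (hborel : borel_space Om)
    (p : nat) (nu : {measure set Om -> \bar R})
    (H : set 'cV[R]_p) (hH : open H)
    (h : Om -> R) (h_meas : measurable_fun setT h) (h_ge0 : forall x, 0 <= h x)
    (T : Om -> 'cV[R]_p)
    (T_meas : forall i, measurable_fun setT (fun x => T x i 0))
    (A : 'cV[R]_p -> R)
    (mu : 'cV[R]_p -> probability Om R)
    (mu_density : forall eta, H eta -> forall B : set Om, measurable B ->
       mu eta B = (\int[nu]_(x in B) (exp_density h T A eta x)%:E)%E)
    (fisher_unit : forall eta, H eta -> hessian A eta \in unitmx)
    (eta0 : 'cV[R]_p) (heta0 : H eta0)
    (d' : measure_display) (S : measurableType d') (P : probability S R)
    (X : {RV P >-> Om})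
    (X_law : forall B : set Om, measurable B -> distribution P X B = mu eta0 B)
    (w1 : Om) (t1 : R) (w2 : Om) (t2 : R) (ht1 : 0 <= t1) (ht2 : 0 <= t2) :
  composite_cov P X mu (score T A) eta0 w1 t1 w2 t2 =
  simple_cov P X (mu eta0) w1 t1 w2 t2
  - ((distance_profile_dot mu eta0 w1 t1)^T *m invmx (hessian A eta0)
       *m distance_profile_dot mu eta0 w2 t2) 0 0.
Proof.
pose U : S -> 'cV[R]_p := T \o X.
have mU : forall i, measurable_fun setT (fun s => U s i 0).
  by move=> i; exact: measurable_stat_comp.
have exp_int_ind B : measurable B ->
    exp_integrable P U H eta0 (fun s => \1_B (X s)).
  move=> mB.
  exact: (exp_integrable_indicator h_meas h_ge0 T_meas mu_density heta0 X_law mB).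
have muE eta B : H eta -> measurable B -> fine (mu eta B) =
    expR (A eta0 - A eta) * exp_integral P U eta0 (fun s => \1_B (X s)) eta.
  move=> Heta mB.
  exact: (mu_exp_integral h_meas h_ge0 T_meas mu_density heta0 X_law Heta mB).
have indT : (fun s => \1_[set: Om] (X s)) = cst (1 : R).
  by apply/funext => s; rewrite indicE in_setT.
have exp_int1 : exp_integrable P U H eta0 (cst 1).
  by rewrite -indT; exact: exp_int_ind.
have expA eta : H eta ->
    expR (A eta - A eta0) = exp_integral P U eta0 (cst 1) eta.
  move=> Heta; have := muE _ _ Heta measurableT; rewrite indT probability_setT/=.
  move=> E; rewrite -opprB expRN -[LHS]mulr1 [X in _ * X]E mulKf//.
  by rewrite gt_eqF// expR_gt0.
set m := fun i => (\int[P]_s U s i 0)%R.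
have gradE : grad A eta0 = \col_i m i.
  apply/colP => i; rewrite !mxE.
  exact: (partial_log_normalizer_at0 hH heta0 mU exp_int1 expA).
have dA := is_derive_partial_log_normalizer hH heta0 mU exp_int1 expA.
have hessE : hessian A eta0 =
    \matrix_(i, j) (\int[P]_s ((U s i 0 - m i) * (U s j 0 - m j)))%R.
  by apply/matrixP => i j; rewrite !mxE; case: (dA i j).
have sym : (hessian A eta0)^T = hessian A eta0.
  rewrite hessE; apply/matrixP => i j; rewrite !mxE.
  by apply: eq_Rintegral => s _; rewrite mulrC.
have fisherE : expectation_mx P
    (fun s => score T A eta0 (X s) *m (score T A eta0 (X s))^T) = hessian A eta0.
  rewrite hessE; apply/matrixP => i j; rewrite !mxE unlock.
  apply: eq_Rintegral => s _.
  by rewrite /score gradE mxE big_ord1 !mxE.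
have scoreE w t : expectation_mx P
    (fun s => ball_indicator w t (X s) *: score T A eta0 (X s)) =
    distance_profile_dot mu eta0 w t.
  have mB := measurable_mdist_le hborel w t.
  have db i := is_derive_tilted_mean hH heta0 mU exp_int1 i (exp_int_ind _ mB).
  apply/colP => i; rewrite !mxE unlock /partial.
  transitivity (\int[P]_s (\1_[set x | mdist w x <= t] (X s) *
      (U s i 0 - m i)))%R.
    by apply: eq_Rintegral => s _; rewrite /score gradE !mxE.
  case: (db i) => _ <-; apply: near_eq_derive.
  have : nbhs eta0 H by exact: open_nbhs_nbhs.
  apply: filterS => eta Heta; rewrite /distance_profile muE// -expA//.
  by rewrite -expRN opprB mulrC.
have VE : derivative_matrix
    (fun eta => expectation_mx P (fun s => score T A eta (X s))) eta0 =
    - hessian A eta0.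
  (* The rows of the derivative matrix are indexed by components and those of
     the Hessian by directions, so [V] is first the transposed Hessian. *)
  rewrite -sym; apply/matrixP => i j; rewrite !mxE {1}/partial.
  have -> : (fun eta => expectation_mx P (fun s => score T A eta (X s)) i 0) =
      cst (m i) - partial i A.
    apply/funext => eta; rewrite mxE unlock fctE.
    have iU := exp_integrable_integrable heta0
      (exp_integrable_stat hH mU exp_int1 i).
    have := @RintegralB _ _ _ P setT _ _ measurableT iU
      (finite_measure_integrable_cst P (partial i A eta) measurableT).
    rewrite Rintegral_prob_cst => <-.
    by apply: eq_Rintegral => s _; rewrite !mxE.
  have := is_deriveB (is_derive_cst (m i) eta0 (delta_mx j 0)) (dA j i).
  by case=> _ ->; rewrite sub0r; case: (dA j i) => _ <-.
exact: (composite_quadratic_form _ (fisher_unit _ heta0) sym VE fisherE).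
Qed.
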